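(* Let $N,m,r,l,k$ be positive integers with $l<m$ and $k<N$. Let $\mathcal F=\{f_1,\dots,f_m\}\subset\mathbb R^N$ be a normalized data set, let $d=\operatorname{rank}(\mathcal F)$ be the rank of the $N\times m$ matrix with columns $f_1,\dots,f_m$, and assume $k\le d$. Let $0<\varepsilon<1$. Assume that $A_\omega\in\mathbb R^{r\times N}$ is a random matrix satisfying the concentration inequality with constants $c_0(\cdot)$, and write $c_0=c_0(\varepsilon)$. For each $\omega$ let $\mathbf S_\omega$ be an optimal partition for $\mathcal F'=A_\omega\mathcal F=\{A_\omega f_1,\dots,A_\omega f_m\}$ in $\mathbb R^r$, and let $B_\omega$ be a bundle in $\mathbb R^N$ generated by the partition $\mathbf S_\omega$ and the data $\mathcal F$. Then with probability exceeding $1-(2m^2+4m)e^{-rc_0}$ we have $$e(\mathcal F,B_\omega)\le(1+\varepsilon)\,e_0(\mathcal F)+\varepsilon c_1,\qquad\text{where } c_1=(l(d-k))^{1/2}.$$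
   Context: Data sets are finite indexed families of vectors (repetitions allowed); $d(\cdot,\cdot)$ with two arguments is Euclidean distance. A bundle in $\mathbb R^n$ is $B=\{V_1,\dots,V_l\}$ (an indexed list of $l$ subspaces of $\mathbb R^n$) with $\dim V_i\le k$ for all $i$. For a data set $\mathcal G=\{g_1,\dots,g_m\}\subset\mathbb R^n$ put $e(\mathcal G,B)=\sum_{i=1}^m\min_{1\le j\le l}d^2(g_i,V_j)$ and $e_0(\mathcal G)=\inf_B e(\mathcal G,B)$, the infimum over all bundles in $\mathbb R^n$. The infimum is attained; a bundle attaining it is called optimal for $\mathcal G$. A partition is a sequence $\mathbf S=\{S_1,\dots,S_l\}$ of pairwise disjoint, possibly empty, subsets of $\{1,\dots,m\}$ with union $\{1,\dots,m\}$. It is generated by the bundle $B=\{V_1,\dots,V_l\}$ (with respect to $\mathcal G$) if $j\in S_i$ implies $d(g_j,V_i)\le d(g_j,V_h)$ for all $h=1,\dots,l$. An optimal partition for $\mathcal G$ is a partition generated by an optimal bundle for $\mathcal G$. A bundle $B=\{V_1,\dots,V_l\}$ is generated by the partition $\mathbf S$ and the data $\mathcal G$ if for every $i$, $\sum_{j\in S_i}d^2(g_j,V_i)\le\sum_{j\in S_i}d^2(g_j,W)$ for all subspaces $W\subseteq\mathbb R^n$ with $\dim W\le k$. $\mathcal F$ is normalized if the matrix with columns $f_1,\dots,f_m$ has Frobenius norm $1$, i.e. $\sum_{i=1}^m\|f_i\|_2^2=1$. Let $(\Omega,\Pr)$ be a probability space. A random matrix $A_\omega\in\mathbb R^{r\times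 N}$ is a matrix whose entries are independent identically distributed random variables on $\Omega$. It satisfies the concentration inequality if for every $0<\varepsilon<1$ there is $c_0=c_0(\varepsilon)>0$ (independent of $r,N$) such that for every $x\in\mathbb R^N$, $\Pr\big((1-\varepsilon)\|x\|_2^2\le\|A_\omega x\|_2^2\le(1+\varepsilon)\|x\|_2^2\big)\ge1-2e^{-rc_0}$. An assertion holds with probability exceeding $p$ if it holds for all $\omega$ in some measurable event of probability greater than $p$. *)

(* Defs.v *)
From HB Require Import structures.
From mathcomp Require Import all_boot all_order all_algebra.
From mathcomp Require Import all_classical all_reals all_analysis.

Set Implicit Arguments.
Unset Strict Implicit.
Unset Printing Implicit Defensive.

Import Order.TTheory GRing.Theory Num.Theory.

Local Open Scope classical_set_scope.
Local Open Scope ring_scope.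

Section Euclidean.
Context {R : realType} {n : nat}.

(* The norm provided by the library on matrices is the sup norm. *)
Definition l2norm (x : 'cV[R]_n) : R := Num.sqrt (\sum_i x i 0 ^+ 2).

Definition dist (x : 'cV[R]_n) (V : {vspace 'cV[R]_n}) : R :=
  inf [set l2norm (x - v) | v in [set v | v \in V]].

End Euclidean.

Section Bundles.
Context {R : realType} {n : nat} (k : nat) {l m : nat}.

Definition is_bundle (B : 'I_l -> {vspace 'cV[R]_n}) : Prop :=
  forall i, (\dim (B i) <= k)%N.

(* For 0 < l the inner infimum ranges over a finite nonempty set, hence is a
   minimum. *)
Definition bundle_error (G : 'I_m -> 'cV[R]_n)
    (B : 'I_l -> {vspace 'cV[R]_n}) : R :=
  \sum_(i < m) inf [set dist (G i) (B j) ^+ 2 | j in [set: 'I_l]].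

End Bundles.

Definition min_error {R : realType} {n : nat} (k l : nat) {m : nat}
    (G : 'I_m -> 'cV[R]_n) : R :=
  inf [set bundle_error G B | B in [set B : 'I_l -> {vspace 'cV[R]_n}
                                      | is_bundle k B]].

Section Partitions.
Context {R : realType} {n : nat} (k : nat) {l m : nat}.
Implicit Types (G : 'I_m -> 'cV[R]_n) (B : 'I_l -> {vspace 'cV[R]_n})
  (S : 'I_l -> {set 'I_m}).

Definition optimal_bundle G B : Prop :=
  is_bundle k B /\ bundle_error G B = min_error k l G.

Definition is_partition S : Prop :=
  (forall i h, i != h -> [disjoint S i & S h]%B) /\
  (forall j, exists i, j \in S i).

Definition partition_generated_by G B S : Prop :=
  is_partition S /\
  forall i j, j \in S i -> forall h, dist (G j) (B i) <= dist (G j) (B h).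

Definition optimal_partition G S : Prop :=
  exists B, optimal_bundle G B /\ partition_generated_by G B S.

Definition bundle_generated_by G S B : Prop :=
  is_bundle k B /\
  forall i (W : {vspace 'cV[R]_n}), (\dim W <= k)%N ->
    \sum_(j in S i) dist (G j) (B i) ^+ 2 <= \sum_(j in S i) dist (G j) W ^+ 2.

End Partitions.

Definition data_mx {R : realType} {n m : nat} (G : 'I_m -> 'cV[R]_n)
  : 'M[R]_(n, m) := \matrix_(i < n, j < m) G j i 0.

Definition normalized {R : realType} {n m : nat} (G : 'I_m -> 'cV[R]_n) : Prop :=
  \sum_(i < m) l2norm (G i) ^+ 2 = 1.

Section RandomMatrices.
Context {d : measure_display} {T : measurableType d} {R : realType}
  {P : probability T R}.

Definition independent_RVs {I : finType} (X : I -> {RV P >-> R}) : Prop :=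
  forall (J : {set I}) (U : I -> set R), (forall i, measurable (U i)) ->
    P (\bigcap_(i in [set i | i \in J]) (X i @^-1` U i)) =
    (\prod_(i in J) P (X i @^-1` U i))%E.

Definition identically_distributed {I : finType} (X : I -> {RV P >-> R}) : Prop :=
  forall (i j : I) (U : set R), measurable U ->
    distribution P (X i) U = distribution P (X j) U.

Context {r N : nat}.
Implicit Type A : 'I_r -> 'I_N -> {RV P >-> R}.

Definition random_matrix A : Prop :=
  independent_RVs (fun p : 'I_r * 'I_N => A p.1 p.2) /\
  identically_distributed (fun p : 'I_r * 'I_N => A p.1 p.2).

Definition sample A (w : T) : 'M[R]_(r, N) := \matrix_(i, j) A i j w.

Definition concentration A (c0 : R -> R) : Prop :=
  forall eps : R, 0 < eps < 1 ->
    0 < c0 eps /\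
    forall x : 'cV[R]_N,
      ((1 - 2 * expR (- (r%:R * c0 eps)))%:E <=
       P [set w | ((1 - eps) * l2norm x ^+ 2 <= l2norm (sample A w *m x) ^+ 2
                  <= (1 + eps) * l2norm x ^+ 2)%R])%E.

End RandomMatrices.

(* Main.v *)
Require Import Defs.
From mathcomp Require Import all_boot all_order all_algebra.
From mathcomp Require Import all_classical all_reals all_analysis.
From mathcomp Require Import measurable_realfun ring lra zify.

Set Implicit Arguments.
Unset Strict Implicit.
Unset Printing Implicit Defensive.

Import Order.TTheory GRing.Theory Num.Theory.

Local Open Scope classical_set_scope.
Local Open Scope ring_scope.

(* Idea. Let M be the matrix of the data of one cell of the partition, D the
   difference of the Gram matrices of M and A M, and Z the matrix of the points
   of a k-dimensional subspace nearest to the columns of A M. If Y has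
   orthonormal rows spanning a (rank M - k)-dimensional subspace of the row
   space of M on which Z vanishes, then M - M Y^T Y has rank at most k and
     |M Y^T|^2 = |A M Y^T|^2 + tr (D Y^T Y) <= |A M - Z|^2 + |D| (rank M - k)^(1/2)
   in Frobenius norm, since A M Y^T = (A M - Z) Y^T. Polarizing the concentration
   inequality at m^2 vectors bounds the entries of D, so |D| is at most eps times
   the sum of the squared norms of the cell. Concentration at m residuals
   f_j - p_j, with p_j nearest to f_j in a bundle for F, gives
   e_0 (A F) <= (1 + eps) e (F, bundle). Only m^2 + m events are used, which
   leaves room for the strict inequality. *)

(** * Frobenius norm, orthonormal rows and low-rank approximation *)

Section Frobenius.
Variable R : rcfType.

Definition frob2 m n (X : 'M[R]_(m, n)) : R := \tr (X *m X^T).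

Lemma frob2E m n (X : 'M[R]_(m, n)) : frob2 X = \sum_i \sum_j X i j ^+ 2.
Proof.
apply: eq_bigr => i _; rewrite !mxE; apply: eq_bigr => j _.
by rewrite !mxE expr2.
Qed.

Lemma frob2_tr m n (X : 'M[R]_(m, n)) : frob2 X^T = frob2 X.
Proof. by rewrite /frob2 trmxK mxtrace_mulC. Qed.

Lemma frob2_ge0 m n (X : 'M[R]_(m, n)) : 0 <= frob2 X.
Proof.
rewrite frob2E; apply: sumr_ge0 => i _; apply: sumr_ge0 => j _; exact: sqr_ge0.
Qed.

Lemma frob2_eq0 m n (X : 'M[R]_(m, n)) : (frob2 X == 0) = (X == 0).
Proof.
apply/eqP/eqP => [|->]; last by rewrite /frob2 mul0mx mxtrace0.
rewrite frob2E => X0; apply/matrixP => i j; rewrite mxE.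
have := psumr_eq0P _ X0 => /(_ (fun i _ => sumr_ge0 _ (fun j _ => sqr_ge0 (X i j)))).
move=> /(_ i isT) /psumr_eq0P => /(_ (fun j _ => sqr_ge0 (X i j))) /(_ j isT).
by move/eqP; rewrite sqrf_eq0 => /eqP.
Qed.

(** Cauchy-Schwarz for the trace inner product, the source of the square root in the additive
    error. *)
Lemma mxtrace_mul_le m n (X Y : 'M[R]_(m, n)) :
  \tr (X *m Y^T) <= Num.sqrt (frob2 X * frob2 Y).
Proof.
have frob2D s t : frob2 (s *: X - t *: Y) =
    s ^+ 2 * frob2 X - 2 * (s * t) * \tr (X *m Y^T) + t ^+ 2 * frob2 Y.
  have trC : \tr (Y *m X^T) = \tr (X *m Y^T).
    by rewrite -mxtrace_tr trmx_mul trmxK.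
  have -> : s *: X - t *: Y = s *: X + (- t) *: Y by rewrite scaleNr.
  rewrite /frob2; have -> : (s *: X + - t *: Y)^T = s *: X^T + - t *: Y^T.
    by rewrite linearD !linearZ.
  rewrite mulmxDl !mulmxDr !mxtraceD.
  rewrite -!scalemxAl -!scalemxAr !mxtraceZ trC; ring.
have [Y0|Y_neq0] := eqVneq Y 0.
  by rewrite Y0 trmx0 mulmx0 mxtrace0 sqrtr_ge0.
have Y_gt0 : 0 < frob2 Y by rewrite lt_neqAle frob2_ge0 eq_sym frob2_eq0 Y_neq0.
apply: (le_trans (ler_norm _)); rewrite -sqrtr_sqr ler_sqrt; last first.
  by rewrite mulr_ge0 ?frob2_ge0.
(* This is the residual of [X] along [Y], scaled by [frob2 Y] to avoid a division; its square is
   [frob2 Y] times the Cauchy-Schwarz defect. *)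
have := frob2_ge0 (frob2 Y *: X - \tr (X *m Y^T) *: Y).
rewrite frob2D => ge0; rewrite -subr_ge0 -(pmulr_rge0 _ Y_gt0).
by apply: le_trans ge0 _; rewrite le_eqVlt; apply/orP; left; apply/eqP; ring.
Qed.

Lemma frob2_mul_orthonormal m n q (X : 'M[R]_(m, q)) (Y : 'M[R]_(q, n)) :
  Y *m Y^T = 1%:M -> frob2 (X *m Y) = frob2 X.
Proof. by move=> YY; rewrite /frob2 trmx_mul mulmxA -(mulmxA X) YY mulmx1. Qed.

(** [X *m Y^T *m Y] is the orthogonal projection of the rows of [X] onto the row space of [Y], and
    [X *m Y^T] holds its coordinates. *)
Lemma frob2_pythagoras m n q (X : 'M[R]_(m, n)) (Y : 'M[R]_(q, n)) :
  Y *m Y^T = 1%:M ->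
  frob2 X = frob2 (X *m Y^T) + frob2 (X - X *m Y^T *m Y).
Proof.
move=> YY; set Z := X *m Y^T.
have YX : Y *m X^T = Z^T by rewrite trmx_mul trmxK.
rewrite /frob2; have -> : (X - Z *m Y)^T = X^T - Y^T *m Z^T.
  by rewrite linearB /= trmx_mul.
rewrite mulmxBl !mulmxBr mulmxA -/Z -(mulmxA Z) YX !mulmxA -(mulmxA Z) YY.
by rewrite mulmx1 subrr subr0 raddfB /= addrC subrK.
Qed.

Lemma orthonormal_rank n q (Y : 'M[R]_(q, n)) : Y *m Y^T = 1%:M -> \rank Y = q.
Proof.
move=> YY; apply/eqP; rewrite eqn_leq rank_leq_row -[X in (X <= _)%N](mxrank1 R).
by rewrite -YY mxrankM_maxl.
Qed.

Lemma orthonormal_rows p n (U : 'M[R]_(p, n)) q : (q <= \rank U)%N ->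
  exists2 Y : 'M[R]_(q, n), Y *m Y^T = 1%:M & (Y <= U)%MS.
Proof.
elim: q => [_|q IHq ltqU].
  by exists 0; [apply/matrixP; case | exact: sub0mx].
have [Y YY YU] := IHq (ltnW ltqU).
(* Gram-Schmidt by a dimension count: [U *m Y^T] has only [q] columns and [q] is below the rank of
   [U], so some nonzero row of the span of [U] is orthogonal to [Y]. It is then normalized and
   stacked on [Y]. *)
have : (U :&: kermx Y^T)%MS != 0.
  rewrite -mxrank_eq0 -lt0n.
  rewrite -(ltn_add2l (\rank (U *m Y^T))) addn0 mxrank_mul_ker.
  exact: leq_ltn_trans (rank_leq_col _) ltqU.
set K := (_ :&: _)%MS; rewrite -nz_row_eq0; set v := nz_row K => v_neq0.
have /andP[vU /sub_kermxP vY] : ((v <= U)%MS && (v <= kermx Y^T)%MS).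
  by rewrite -sub_capmx nz_row_sub.
have v_gt0 : 0 < frob2 v by rewrite lt_neqAle frob2_ge0 eq_sym frob2_eq0 v_neq0.
set u := (Num.sqrt (frob2 v))^-1 *: v.
have uu : u *m u^T = 1%:M.
  rewrite [LHS]mx11_scalar -trace_mx11.
  rewrite /u linearZ /= -scalemxAl -scalemxAr scalerA linearZ /= -/(frob2 v).
  rewrite -invfM -expr2 sqr_sqrtr ?ltW // mulVf ?gt_eqF //.
have uY : u *m Y^T = 0 by rewrite /u -scalemxAl vY scaler0.
have Yu : Y *m u^T = 0 by apply: trmx_inj; rewrite trmx_mul trmxK uY trmx0.
rewrite -add1n; exists (col_mx u Y).
  by rewrite tr_col_mx mul_col_row uu uY Yu YY -scalar_mx_block.
by rewrite col_mx_sub YU scalemx_sub.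
Qed.

Lemma low_rank_approx N r p k (M : 'M[R]_(N, p)) (M' Z : 'M[R]_(r, p)) :
  (\rank Z <= k)%N ->
  exists2 L : 'M[R]_(N, p), (\rank L <= k)%N &
    frob2 (M - L) <= frob2 (M' - Z) +
      Num.sqrt ((\rank M - k)%:R * frob2 (M^T *m M - M'^T *m M')).
Proof.
move=> Zk; set D := _ - M'^T *m M'.
(* There is room for [Y]: [M *m Z^T] has rank at most [k], so rank-nullity leaves at least
   [\rank M - k] dimensions of the row space of [M] on which [Z] vanishes. *)
have [|Y YY] := @orthonormal_rows _ _ (M :&: kermx Z^T)%MS (\rank M - k).
  rewrite leq_subLR -(mxrank_mul_ker M Z^T) leq_add2r.
  by rewrite (leq_trans (mxrankM_maxr _ _)) // mxrank_tr.
rewrite sub_capmx => /andP[YM /sub_kermxP YZ].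
have ZY : Z *m Y^T = 0 by apply: trmx_inj; rewrite trmx_mul trmxK YZ trmx0.
exists (M - M *m Y^T *m Y).
  have LY : (M - M *m Y^T *m Y) *m Y^T = 0.
    by rewrite mulmxBl -!mulmxA YY mulmx1 subrr.
  have Yrank := orthonormal_rank YY.
  (* The row spaces of [Y] and of the approximant are independent and both lie in that of [M], so
     their ranks add up to at most [\rank M]. *)
  have disj : ((M - M *m Y^T *m Y) :&: Y)%MS = 0.
    apply/eqP/rowV0P => v; rewrite sub_capmx => /andP[/submxP[a va] /submxP[b vb]].
    have: v *m Y^T = 0 by rewrite va -mulmxA LY mulmx0.
    by rewrite {1}vb -mulmxA YY mulmx1 vb => ->; rewrite mul0mx.
  have LM : ((M - M *m Y^T *m Y) + Y <= M)%MS.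
    rewrite addsmx_sub YM andbT addmx_sub // eqmx_opp.
    exact: submx_trans (submxMl _ _) YM.
  have := mxrankS LM; rewrite (mxrank_disjoint_sum disj) Yrank.
  have : (\rank (M - M *m Y^T *m Y)%R <= \rank M)%N.
    by rewrite mxrankS // (submx_trans _ LM) ?addsmxSl.
  lia.
rewrite opprB addrC subrK frob2_mul_orthonormal //.
have -> : frob2 (M *m Y^T) = frob2 (M' *m Y^T) + \tr (D *m (Y^T *m Y)).
  have trE s (X : 'M[R]_(s, p)) :
      frob2 (X *m Y^T) = \tr (X^T *m X *m (Y^T *m Y)).
    by rewrite /frob2 trmx_mul trmxK -!mulmxA [RHS]mxtrace_mulC !mulmxA.
  by rewrite !trE -mxtraceD -mulmxDl /D addrC subrK.
apply: lerD.
  have -> : M' *m Y^T = (M' - Z) *m Y^T by rewrite mulmxBl ZY subr0.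
  by rewrite (frob2_pythagoras (M' - Z) YY) lerDl frob2_ge0.
(* The orthogonal projection [Y^T *m Y] has squared Frobenius norm equal to its rank [\rank M - k];
   Cauchy-Schwarz against [D] gives the root. *)
have PT : (Y^T *m Y)^T = Y^T *m Y by rewrite trmx_mul trmxK.
rewrite -{1}PT; apply: (le_trans (mxtrace_mul_le _ _)).
rewrite frob2_mul_orthonormal // frob2_tr /frob2 YY mxtrace1.
by rewrite mulrC.
Qed.

End Frobenius.

(** * Euclidean distance to a subspace *)

Section Distance.
Variables (R : realType) (n : nat).
Implicit Types (x v : 'cV[R]_n) (V : {vspace 'cV[R]_n}).

Lemma l2norm_ge0 x : 0 <= l2norm x. Proof. exact: sqrtr_ge0. Qed.

Lemma l2norm_sqr x : l2norm x ^+ 2 = frob2 x.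
Proof.
rewrite sqr_sqrtr ?sumr_ge0 // => [|i _]; last exact: sqr_ge0.
by rewrite frob2E; apply: eq_bigr => i _; rewrite big_ord1.
Qed.

Lemma l2norm_eq0 x : (l2norm x == 0) = (x == 0).
Proof. by rewrite -sqrf_eq0 l2norm_sqr frob2_eq0. Qed.

Lemma frob2_col p (M : 'M[R]_(n, p)) : frob2 M = \sum_j l2norm (col j M) ^+ 2.
Proof.
rewrite frob2E exchange_big; apply: eq_bigr => j _ /=.
by rewrite l2norm_sqr frob2E; apply: eq_bigr => i _; rewrite big_ord1 mxE.
Qed.

Lemma has_lbound_dist x V : has_lbound [set l2norm (x - v) | v in [set v | v \in V]].
Proof. by exists 0 => _ [v _ <-]; exact: l2norm_ge0. Qed.

Lemma dist_le x v V : v \in V -> dist x V <= l2norm (x - v).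
Proof. by move=> vV; apply: ge_inf (has_lbound_dist x V) _ _; exists v. Qed.

Lemma dist_ge x V c : (forall v, v \in V -> c <= l2norm (x - v)) -> c <= dist x V.
Proof.
move=> cV; apply: lb_le_inf => [|_ [v vV <-]]; last exact: cV.
by exists (l2norm (x - 0)), 0 => //=; exact: mem0v.
Qed.

Lemma dist_ge0 x V : 0 <= dist x V.
Proof. by apply: dist_ge => v _; exact: l2norm_ge0. Qed.

Lemma dist_sqr_le x v V : v \in V -> dist x V ^+ 2 <= l2norm (x - v) ^+ 2.
Proof. by move=> vV; rewrite ler_pXn2r ?nnegrE ?dist_ge0 ?l2norm_ge0 ?dist_le. Qed.

(** Passes from an abstract subspace to a row space, where the matrix lemmas apply. *)
Lemma vspace_row_span V :
  exists M : 'M[R]_(\dim V, n), forall v, (v \in V) = (v^T <= M)%MS.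
Proof.
exists (\matrix_(i < \dim V) ((vbasis V)`_i)^T) => v; apply/idP/submxP.
  move=> vV; exists (\row_i coord (vbasis V) i v).
  rewrite mulmx_sum_row {1}(coord_vbasis vV) linear_sum /=.
  by apply: eq_bigr => i _; rewrite linearZ mxE rowK.
case=> D; rewrite mulmx_sum_row => /(congr1 trmx); rewrite trmxK => ->.
rewrite linear_sum /= memv_suml // => i _; rewrite linearZ /= rowK trmxK.
by rewrite memvZ // vbasis_mem // mem_nth // size_tuple.
Qed.

(** The orthogonal projection is the minimizer: all the differences [x - w] with [w] in [V] share
    the same component orthogonal to [V], so Pythagoras applies. *)
Lemma dist_attained x V : exists2 v, v \in V & dist x V = l2norm (x - v).
Proof.
have [M VM] := vspace_row_span V.
have [Y YY YM] := orthonormal_rows (leqnn (\rank M)).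
have Yrank := orthonormal_rank YY.
have MY : (M <= Y)%MS by rewrite -(mxrank_leqif_sup YM) Yrank.
have yV : (x^T *m Y^T *m Y)^T \in V.
  by rewrite VM trmxK (submx_trans (submxMl _ _)).
exists (x^T *m Y^T *m Y)^T => //; apply/le_anti/andP; split; first exact: dist_le.
apply: dist_ge => w; rewrite VM => /submx_trans /(_ MY) /submxP[D wD].
rewrite -(@ler_pXn2r _ 2) ?nnegrE ?l2norm_ge0 // !l2norm_sqr.
rewrite -(frob2_tr (x - w)) (frob2_pythagoras _ YY).
have -> : (x - w)^T - (x - w)^T *m Y^T *m Y = (x - (x^T *m Y^T *m Y)^T)^T.
  rewrite linearB /= [(x - _^T)^T]linearB /= trmxK wD !mulmxBl -(mulmxA D) YY mulmx1.
  by rewrite opprB addrA subrK.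
by rewrite frob2_tr lerDr frob2_ge0.
Qed.

Lemma column_space p (L : 'M[R]_(n, p)) :
  exists2 V, (\dim V <= \rank L)%N & forall j, col j L \in V.
Proof.
pose X := [seq col i (col_base L) | i : 'I_(\rank L)].
exists <<X>>%VS; first by rewrite (leq_trans (dim_span _)) // size_map size_enum_ord.
move=> j; have -> : col j L = \sum_i row_base L i j *: col i (col_base L).
  apply/colP => a; rewrite -{1}(mulmx_base L) summxE !mxE.
  by apply: eq_bigr => i _; rewrite !mxE mulrC.
apply: memv_suml => i _; rewrite memvZ // memv_span //.
by apply/mapP; exists i; rewrite ?mem_enum.
Qed.

End Distance.

(** * Best fit of one cell under a change of Gram matrix *)

Definition dot (R : realType) n (u v : 'cV[R]_n) : R := (u^T *m v) 0 0.

Lemma dot_self (R : realType) n (u : 'cV[R]_n) : dot u u = l2norm u ^+ 2.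
Proof. by rewrite l2norm_sqr -frob2_tr /frob2 trmxK trace_mx11. Qed.

Lemma best_fit_perturbation (R : realType) N r m k (G : 'I_m -> 'cV[R]_N)
    (G' : 'I_m -> 'cV[R]_r) (T : {set 'I_m}) (V : {vspace 'cV[R]_r}) :
  (\dim V <= k)%N ->
  exists2 W : {vspace 'cV[R]_N}, (\dim W <= k)%N &
    \sum_(j in T) dist (G j) W ^+ 2 <= \sum_(j in T) dist (G' j) V ^+ 2 +
      Num.sqrt ((\rank (data_mx G) - k)%:R *
        \sum_(a in T) \sum_(b in T) (dot (G a) (G b) - dot (G' a) (G' b)) ^+ 2).
Proof.
move=> Vk.
have /choice[z zP] : forall j, exists v, v \in V /\ dist (G' j) V = l2norm (G' j - v).
  by move=> j; have [v vV dv] := dist_attained (G' j) V; exists v.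
(* Columns outside the cell are zeroed rather than removed, which keeps [m] columns throughout; a
   zero column adds nothing to norms, Gram sums or ranks. *)
pose mask n (H : 'I_m -> 'cV[R]_n) : 'M[R]_(n, m) :=
  \matrix_(i, j) (if j \in T then H j i 0 else 0).
have colmask n (H : 'I_m -> 'cV[R]_n) j :
    col j (mask n H) = if j \in T then H j else 0.
  by apply/colP => i; rewrite !mxE; case: ifP => // _; rewrite mxE.
have gram n (H : 'I_m -> 'cV[R]_n) a b : ((mask n H)^T *m mask n H) a b =
    if (a \in T) && (b \in T) then dot (H a) (H b) else 0.
  rewrite mxE; case: ifP => [/andP[aT bT]|abT].
    by rewrite /dot mxE; apply: eq_bigr => i _; rewrite !mxE aT bT.
  rewrite big1 // => i _; rewrite !mxE.
  by move: abT; case: (a \in T); case: (b \in T); rewrite ?mul0r ?mulr0.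
have zk : (\rank (mask r z) <= k)%N.
  have [M VM] := vspace_row_span V.
  rewrite (leq_trans _ Vk) // (leq_trans _ (rank_leq_row M)) // -mxrank_tr mxrankS //.
  apply/row_subP => j; rewrite -tr_col colmask -VM.
  by case: ifP => _; [case: (zP j) | exact: mem0v].
have [L Lk LE] := low_rank_approx (mask N G) (mask r G') zk.
have [W WL WP] := column_space L.
exists W; first exact: leq_trans WL Lk.
apply: (@le_trans _ _ (frob2 (mask N G - L))).
  rewrite frob2_col [leRHS](bigID (mem T)) /= -[leLHS]addr0 lerD //; last first.
    by apply: sumr_ge0 => j _; exact: sqr_ge0.
  apply: ler_sum => j jT.
  have -> : col j (mask N G - L) = G j - col j L.
    by rewrite linearB /= colmask jT.
  exact: dist_sqr_le.
apply: (le_trans LE); apply: lerD.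
  rewrite frob2_col (bigID (mem T)) /= [X in _ + X]big1 ?addr0.
    apply: ler_sum => j jT; rewrite linearB /= !colmask jT.
    by have [_ ->] := zP j.
  move=> j jT; rewrite linearB /= !colmask (negbTE jT) subrr.
  by apply/eqP; rewrite sqrf_eq0 l2norm_eq0.
apply: ler_wsqrtr; apply: ler_pM; rewrite ?ler0n ?frob2_ge0 //.
  rewrite ler_nat leq_sub2r //.
  (* Masking is right multiplication by a 0-1 diagonal matrix, so the rank stays at most that of all
     the data. *)
  have -> : mask N G = data_mx G *m diag_mx (\row_j (j \in T)%:R).
    apply/matrixP => i j; rewrite mul_mx_diag !mxE.
    by case: ifP => _; rewrite ?mulr1 ?mulr0.
  exact: mxrankM_maxl.
have subE (X Y : 'M[R]_m) a b : (X - Y) a b = X a b - Y a b by rewrite !mxE.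
rewrite frob2E (bigID (mem T)) /= [X in _ + X]big1 ?addr0; last first.
  move=> a aT; rewrite big1 // => b _.
  by rewrite subE !gram (negbTE aT) subrr expr0n.
apply: ler_sum => a aT; rewrite (bigID (mem T)) /= [X in _ + X]big1 ?addr0; last first.
  by move=> b bT; rewrite subE !gram (negbTE bT) andbF subrr expr0n.
by apply: ler_sum => b bT; rewrite subE !gram aT bT.
Qed.

(** The entrywise bounds are products, so their squares sum to the square of [eps] times the energy
    of the cell, and the root becomes linear in that energy. *)
Lemma best_fit_gram_bound (R : realType) N r m k (G : 'I_m -> 'cV[R]_N)
    (G' : 'I_m -> 'cV[R]_r) (T : {set 'I_m}) (V : {vspace 'cV[R]_r}) (eps : R) :
  0 <= eps ->
  (forall a b, `|dot (G a) (G b) - dot (G' a) (G' b)|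
     <= eps * (l2norm (G a) * l2norm (G b))) ->
  (\dim V <= k)%N ->
  exists2 W : {vspace 'cV[R]_N}, (\dim W <= k)%N &
    \sum_(j in T) dist (G j) W ^+ 2 <= \sum_(j in T) dist (G' j) V ^+ 2 +
      eps * Num.sqrt (\rank (data_mx G) - k)%:R * \sum_(j in T) l2norm (G j) ^+ 2.
Proof.
move=> eps0 gram Vk; have [W Wk WE] := best_fit_perturbation G G' T Vk.
exists W => //; apply: (le_trans WE); rewrite lerD2l.
set s := \sum_(j in T) l2norm _ ^+ 2; set q := (_ - k)%:R.
have s0 : 0 <= s by apply: sumr_ge0 => j _; exact: sqr_ge0.
rewrite sqrtrM ?ler0n // [eps * _]mulrC -mulrA ler_wpM2l ?sqrtr_ge0 //.
rewrite -[leRHS]ger0_norm ?mulr_ge0 // -sqrtr_sqr; apply: ler_wsqrtr.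
rewrite exprMn (expr2 s) /s mulr_suml mulr_sumr; apply: ler_sum => a _.
rewrite !mulr_sumr; apply: ler_sum => b _.
rewrite -!exprMn -real_normK ?num_real // ler_pXn2r ?nnegrE ?mulr_ge0 ?l2norm_ge0 //.
Qed.

(** * Errors of bundles and partitions *)

Section BundleErrors.
Variables (R : realType) (n k l m : nat).
Implicit Types (G : 'I_m -> 'cV[R]_n) (B : 'I_l -> {vspace 'cV[R]_n})
  (S : 'I_l -> {set 'I_m}).

Lemma inf_dist_le G B i j :
  inf [set dist (G i) (B j) ^+ 2 | j in [set: 'I_l]] <= dist (G i) (B j) ^+ 2.
Proof.
by apply: ge_inf; [exists 0 => _ [h _ <-]; exact: sqr_ge0 | exists j].
Qed.

Lemma inf_dist_eq G B i j : (forall h, dist (G i) (B j) <= dist (G i) (B h)) ->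
  inf [set dist (G i) (B j) ^+ 2 | j in [set: 'I_l]] = dist (G i) (B j) ^+ 2.
Proof.
move=> ij; apply/le_anti; rewrite inf_dist_le; apply: lb_le_inf.
  by exists (dist (G i) (B j) ^+ 2), j.
by move=> _ [h _ <-]; rewrite ler_pXn2r ?nnegrE ?dist_ge0 ?ij.
Qed.

Lemma nearest_subspace G B : (0 < l)%N ->
  exists c : 'I_m -> 'I_l, forall i h, dist (G i) (B (c i)) <= dist (G i) (B h).
Proof.
move=> l_gt0.
suff /choice[c cP] : forall i, exists j, forall h, dist (G i) (B j) <= dist (G i) (B h).
  by exists c.
move=> i; pose f j := dist (G i) (B j).
case: (@arg_minP _ _ _ (Ordinal l_gt0) xpredT f) => // j _ jP.
by exists j => h; exact: jP.
Qed.

Lemma bundle_error_ge0 G B : (0 < l)%N -> 0 <= bundle_error G B.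
Proof.
move=> l_gt0; have [c cP] := nearest_subspace G B l_gt0.
by apply: sumr_ge0 => i _; rewrite (inf_dist_eq (cP i)) sqr_ge0.
Qed.

(** A labelling of the indices turns double sums over cells into single sums over data; empty cells
    are labels never taken. *)
Lemma partition_label S : is_partition S ->
  exists c : 'I_m -> 'I_l, forall j i, (j \in S i) = (i == c j).
Proof.
move=> [disj /choice[c cP]]; exists c => j i; apply/idP/eqP => [ji|-> //].
apply/eqP/negPn/negP => /disj; move/pred0P => /(_ j) /=.
by rewrite ji cP.
Qed.

Lemma partition_sum S (c : 'I_m -> 'I_l) (h : 'I_l -> 'I_m -> R) :
  (forall j i, (j \in S i) = (i == c j)) ->
  \sum_i \sum_(j in S i) h i j = \sum_j h (c j) j.
Proof.
move=> cP; rewrite (exchange_big_dep xpredT) //=; apply: eq_bigr => j _.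
by rewrite (eq_bigl (pred1 (c j))) ?big_pred1_eq // => i; rewrite cP.
Qed.

Lemma bundle_error_le_partition G B S : is_partition S ->
  bundle_error G B <= \sum_i \sum_(j in S i) dist (G j) (B i) ^+ 2.
Proof.
move=> /partition_label[c cP].
by rewrite (partition_sum (fun i j => _) cP); apply: ler_sum => j _; exact: inf_dist_le.
Qed.

Lemma bundle_error_partition G B S : partition_generated_by G B S ->
  bundle_error G B = \sum_i \sum_(j in S i) dist (G j) (B i) ^+ 2.
Proof.
move=> [/partition_label[c cP] gen].
rewrite (partition_sum (fun i j => _) cP); apply: eq_bigr => j _.
by apply: inf_dist_eq => h; apply: gen; rewrite cP.
Qed.

Lemma has_inf_bundle_error G : (0 < l)%N ->
  has_inf [set bundle_error G B |
    B in [set B : 'I_l -> {vspace 'cV[R]_n} | is_bundle k B]].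
Proof.
move=> l_gt0; split.
  exists (bundle_error G ((fun=> 0%VS) : 'I_l -> _)), (fun=> 0%VS) => // i.
  by rewrite dimv0.
by exists 0 => _ [B _ <-]; exact: bundle_error_ge0.
Qed.

Lemma min_error_le G B : (0 < l)%N -> is_bundle k B ->
  min_error k l G <= bundle_error G B.
Proof.
move=> l_gt0 kB; apply: ge_inf; last by exists B.
by case: (has_inf_bundle_error G l_gt0).
Qed.

Lemma min_error_adherent G d : (0 < l)%N -> 0 < d ->
  exists2 B : 'I_l -> {vspace 'cV[R]_n},
    is_bundle k B & bundle_error G B < min_error k l G + d.
Proof.
move=> l_gt0 d_gt0.
have [_ [B kB <-] Bd] := inf_adherent d_gt0 (has_inf_bundle_error G l_gt0).
by exists B.
Qed.

(** Depends on the cell alone, not on the subspace chosen for it, so it takes finitely many values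
    as the partition varies with the sample. *)
Definition fit_error G (T : {set 'I_m}) : R :=
  inf [set \sum_(j in T) dist (G j) W ^+ 2 |
        W in [set W : {vspace 'cV[R]_n} | (\dim W <= k)%N]].

Lemma fit_error_le G T (W : {vspace 'cV[R]_n}) : (\dim W <= k)%N ->
  fit_error G T <= \sum_(j in T) dist (G j) W ^+ 2.
Proof.
move=> Wk; apply: ge_inf; last by exists W.
by exists 0 => _ [V _ <-]; apply: sumr_ge0 => j _; exact: sqr_ge0.
Qed.

Lemma generated_bundle_error_le G B S :
  is_partition S -> bundle_generated_by k G S B ->
  bundle_error G B <= \sum_i fit_error G (S i).
Proof.
move=> partS [_ opt]; apply: (le_trans (bundle_error_le_partition G B partS)).
apply: ler_sum => i _; apply: lb_le_inf => [|_ [W Wk <-]]; last exact: opt.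
by exists (\sum_(j in S i) dist (G j) 0%VS ^+ 2), 0%VS; rewrite //= dimv0.
Qed.

End BundleErrors.

(** * Inner products and near-isometries, with their effect on errors *)

Section DotProduct.
Variables (R : realType) (n : nat).
Implicit Types u v w : 'cV[R]_n.

Lemma dotC u v : dot u v = dot v u.
Proof. by rewrite /dot !mxE; apply: eq_bigr => i _; rewrite !mxE mulrC. Qed.

Lemma dotDr u v w : dot u (v + w) = dot u v + dot u w.
Proof. by rewrite /dot mulmxDr mxE. Qed.

Lemma dotZr a u v : dot u (a *: v) = a * dot u v.
Proof. by rewrite /dot -scalemxAr mxE. Qed.

Lemma dotZl a u v : dot (a *: u) v = a * dot u v.
Proof. by rewrite dotC dotZr dotC. Qed.

Lemma l2norm_sqrZD a u v :
  l2norm (u + a *: v) ^+ 2 = l2norm u ^+ 2 + 2 * a * dot u v + a ^+ 2 * l2norm v ^+ 2.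
Proof.
rewrite -!dot_self dotDr dotZr ![dot (_ + _) _]dotC !dotDr !dotZr (dotC v u); ring.
Qed.

Lemma l2normZ a u : l2norm (a *: u) = `|a| * l2norm u.
Proof.
apply/eqP; rewrite -(@eqrXn2 _ 2) ?mulr_ge0 ?l2norm_ge0 //.
by rewrite exprMn real_normK ?num_real // -!dot_self dotZr dotZl expr2 mulrA.
Qed.

End DotProduct.

Definition almost_isometric (R : realType) r N (eps : R) (M : 'M[R]_(r, N))
    (x : 'cV[R]_N) :=
  (1 - eps) * l2norm x ^+ 2 <= l2norm (M *m x) ^+ 2 <= (1 + eps) * l2norm x ^+ 2.

(** Since the inverse of 0 is 0, the zero vector goes to itself; hence norm at most 1 below, not
    equal to 1. *)
Definition unit_dir (R : realType) n (x : 'cV[R]_n) : 'cV[R]_n := (l2norm x)^-1 *: x.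

Lemma unit_dirK (R : realType) n (x : 'cV[R]_n) : x = l2norm x *: unit_dir x.
Proof.
rewrite /unit_dir scalerA; have [/eqP|x_neq0] := eqVneq (l2norm x) 0.
  by rewrite l2norm_eq0 => /eqP ->; rewrite scaler0.
by rewrite mulfV // scale1r.
Qed.

Lemma l2norm_unit_dir_le1 (R : realType) n (x : 'cV[R]_n) : l2norm (unit_dir x) <= 1.
Proof.
rewrite l2normZ ger0_norm ?invr_ge0 ?l2norm_ge0 //.
by have [->|x_neq0] := eqVneq (l2norm x) 0; rewrite ?mulr0 ?mulVf.
Qed.

(** Polarization: four times the inner product is the difference of the squared norms of [u + v] and
    [u - v]. The errors add up to at most [eps] times the sum of these squares, which by the
    parallelogram law is at most 4. *)
Lemma almost_isometric_dot (R : realType) r N (eps : R) (M : 'M[R]_(r, N))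
    (u v : 'cV[R]_N) :
  0 <= eps -> l2norm u <= 1 -> l2norm v <= 1 ->
  almost_isometric eps M (u + v) -> almost_isometric eps M (u - v) ->
  `|dot u v - dot (M *m u) (M *m v)| <= eps.
Proof.
move=> eps0 u1 v1; rewrite /almost_isometric.
have -> : u + v = u + 1 *: v by rewrite scale1r.
have -> : u - v = u + (-1) *: v by rewrite scaleN1r.
rewrite !mulmxDr -!scalemxAr !l2norm_sqrZD.
have : l2norm u ^+ 2 <= 1 by rewrite expr_le1 ?l2norm_ge0.
have : l2norm v ^+ 2 <= 1 by rewrite expr_le1 ?l2norm_ge0.
set a := l2norm u ^+ 2; set b := l2norm v ^+ 2; set p := dot u v.
move: (l2norm _ ^+ 2) (l2norm _ ^+ 2) (dot _ _) => a' b' p' b1 a1.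
have : eps * a <= eps by rewrite ler_piMr.
have : eps * b <= eps by rewrite ler_piMr.
move=> ? ? /andP[? ?] /andP[? ?]; rewrite ler_norml; apply/andP; split; nra.
Qed.

(* [u + v] is attached to one ordering of a pair of indices and [u - v] to the
   other, so that [m ^ 2] vectors control all inner products. *)
Definition polar_vector (R : realType) N m (F : 'I_m -> 'cV[R]_N)
    (ij : 'I_m * 'I_m) : 'cV[R]_N :=
  if (ij.1 <= ij.2)%N then unit_dir (F ij.1) + unit_dir (F ij.2)
  else unit_dir (F ij.1) - unit_dir (F ij.2).

Lemma almost_isometric_gram (R : realType) r N m (eps : R) (M : 'M[R]_(r, N))
    (F : 'I_m -> 'cV[R]_N) :
  0 <= eps -> (forall ij, almost_isometric eps M (polar_vector F ij)) ->
  forall a b, `|dot (F a) (F b) - dot (M *m F a) (M *m F b)|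
    <= eps * (l2norm (F a) * l2norm (F b)).
Proof.
move=> eps0 iso a b.
wlog ab : a b / (a <= b)%N.
  move=> W; have [/W//|/ltnW/W] := leqP a b.
  by rewrite dotC (dotC (M *m _)) (mulrC (l2norm _)).
have isoD : almost_isometric eps M (unit_dir (F a) + unit_dir (F b)).
  by have := iso (a, b); rewrite /polar_vector /= ab.
have isoB : almost_isometric eps M (unit_dir (F a) - unit_dir (F b)).
  have := iso (b, a); rewrite /polar_vector /=; case: leqP => [ba|_].
    (* On the diagonal no difference vector is attached, but it is zero and the claim is trivial. *)
    have -> : a = b by apply/val_inj/eqP; rewrite eqn_leq ab ba.
    have norm0 s : l2norm (0 : 'cV[R]_s) = 0 by apply/eqP; rewrite l2norm_eq0.
    by rewrite subrr /almost_isometric mulmx0 !norm0 expr0n /= !mulr0 lexx.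
  have normN s (x y : 'cV[R]_s) : l2norm (x - y) = l2norm (y - x).
    by rewrite -opprB -scaleN1r l2normZ normrN1 mul1r.
  by rewrite /almost_isometric normN !mulmxBr (normN _ (M *m unit_dir (F a))).
have := almost_isometric_dot eps0 (l2norm_unit_dir_le1 (F a))
  (l2norm_unit_dir_le1 (F b)) isoD isoB.
set u := unit_dir (F a); set v := unit_dir (F b) => duv.
rewrite [in dot (F a)](unit_dirK (F a)) [in dot _ (F b)](unit_dirK (F b)).
rewrite [in M *m F a](unit_dirK (F a)) [in M *m F b](unit_dirK (F b)) -/u -/v.
move: u v duv => u v duv.
have dotZ s al be (y z : 'cV[R]_s) : dot (al *: y) (be *: z) = al * be * dot y z.
  by rewrite dotZl dotZr mulrA.
rewrite -!scalemxAr !dotZ -mulrBr normrM mulrC.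
have ab0 : 0 <= l2norm (F a) * l2norm (F b) by rewrite mulr_ge0 ?l2norm_ge0.
by rewrite (ger0_norm ab0) ler_wpM2r.
Qed.

(** The images under [M] of the subspaces of [B] form a competing bundle, and [M *m p j] is an
    admissible point for [M *m F j]. *)
Lemma bundle_image_error (R : realType) r N k l m (eps : R) (M : 'M[R]_(r, N))
    (F p : 'I_m -> 'cV[R]_N) (B : 'I_l -> {vspace 'cV[R]_N}) (c : 'I_m -> 'I_l) :
  (0 < l)%N -> 0 <= eps -> is_bundle k B ->
  (forall j h, dist (F j) (B (c j)) <= dist (F j) (B h)) ->
  (forall j, p j \in B (c j) /\ dist (F j) (B (c j)) = l2norm (F j - p j)) ->
  (forall j, almost_isometric eps M (F j - p j)) ->
  min_error k l (fun j => M *m F j) <= (1 + eps) * bundle_error F B.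
Proof.
move=> l_gt0 eps0 kB cP pP iso.
pose f : 'Hom('cV[R]_N, 'cV[R]_r) := linfun (mulmx M).
pose B' i := (f @: B i)%VS.
have kB' : is_bundle k B'.
  by move=> i; rewrite (leq_trans _ (kB i)) // -(limg_ker_dim f) leq_addl.
apply: (le_trans (min_error_le (fun j => M *m F j) l_gt0 kB')).
rewrite mulr_sumr; apply: ler_sum => j _.
apply: (le_trans (inf_dist_le (fun j => M *m F j) B' j (c j))).
rewrite (inf_dist_eq (cP j)).
have [pB ->] := pP j; have /andP[_] := iso j; rewrite mulmxBr => /(le_trans _); apply.
apply: dist_sqr_le; have -> : M *m p j = f (p j) by rewrite lfunE.
exact: memv_img.
Qed.

Lemma partition_fit_error_le (R : realType) r N k l m (eps : R) (M : 'M[R]_(r, N))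
    (F : 'I_m -> 'cV[R]_N) (S : 'I_l -> {set 'I_m}) :
  0 <= eps -> normalized F ->
  (forall ij, almost_isometric eps M (polar_vector F ij)) ->
  optimal_partition k (fun j => M *m F j) S ->
  \sum_i fit_error k F (S i) <= min_error k l (fun j => M *m F j)
    + eps * Num.sqrt (\rank (data_mx F) - k)%:R.
Proof.
move=> eps0 normF iso [B [[kB <-] gen]]; rewrite (bundle_error_partition gen).
(* As the total energy is 1, the additive term splits over the cells in proportion to their
   energies, without a factor depending on [l]. *)
have -> : eps * Num.sqrt (\rank (data_mx F) - k)%:R =
    \sum_i eps * Num.sqrt (\rank (data_mx F) - k)%:R
      * \sum_(j in S i) l2norm (F j) ^+ 2.
  have [/partition_label[c cP] _] := gen.
  by rewrite -mulr_sumr (partition_sum (fun _ j => l2norm (F j) ^+ 2) cP) normF mulr1.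
rewrite -big_split; apply: ler_sum => i _ /=.
have gram := almost_isometric_gram eps0 iso.
have [W Wk WE] := best_fit_gram_bound (S i) eps0 gram (kB i).
exact: le_trans (fit_error_le F (S i) Wk) WE.
Qed.

(** * Measurability and the union bound *)

Section Probability.
Context {d : measure_display} {T : measurableType d} {R : realType}.
Variable P : probability T R.

Lemma measurable_almost_isometric r N (A : 'I_r -> 'I_N -> {RV P >-> R}) eps x :
  measurable [set w | almost_isometric eps (sample A w) x].
Proof.
have -> : [set w | almost_isometric eps (sample A w) x] =
    (fun w => l2norm (sample A w *m x) ^+ 2) @^-1`
      `[(1 - eps) * l2norm x ^+ 2, (1 + eps) * l2norm x ^+ 2].
  by apply/seteqP; split => w /=; rewrite in_itv.
rewrite -[X in measurable X]setTI; apply: (_ : measurable_fun _ _) => //.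
have -> : (fun w => l2norm (sample A w *m x) ^+ 2) =
    (fun w => \sum_i (\sum_j A i j w * x j 0) ^+ 2).
  apply/funext => w; rewrite l2norm_sqr frob2E; apply: eq_bigr => i _.
  rewrite big_ord1 mxE; congr (_ ^+ 2); apply: eq_bigr => j _.
  by rewrite mxE.
apply: measurable_sum => i; apply: measurable_funX; apply: measurable_sum => j.
by apply: measurable_funM.
Qed.

Lemma probability_forall_ge (I : finType) (E : I -> set T) (delta : R) :
  (forall i, measurable (E i)) -> (forall i, (1 - delta)%:E <= P (E i))%E ->
  measurable [set w | forall i, E i w] /\
  ((1 - #|I|%:R * delta)%:E <= P [set w | forall i, E i w])%E.
Proof.
move=> mE PE.
have compl A a : measurable A ->
    ((1 - a)%:E <= P A)%E = (P (~` A) <= a%:E)%E.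
  move=> mA; rewrite probability_setC //.
  have : P A \is a fin_num by rewrite fin_num_measure.
  by move=> /fineK <-; rewrite -EFinB !lee_fin; apply/idP/idP; lra.
(* Union bound on complements, by induction on a list that is finally taken to enumerate [I]. *)
have : forall s : seq I, measurable [set w | forall i, i \in s -> E i w] /\
    (P (~` [set w | forall i, i \in s -> E i w]) <= ((size s)%:R * delta)%:E)%E.
  elim=> [|i s [ms Ps]].
    have -> : [set w | forall i, i \in [::] -> E i w] = setT by apply/seteqP; split.
    by rewrite setCT measure0 mul0r; split.
  have -> : [set w | forall j, j \in i :: s -> E j w] =
      E i `&` [set w | forall j, j \in s -> E j w].
    apply/seteqP; split => w /= => [Ew|[Ei Es] j].
      by split=> [|j js]; apply: Ew; rewrite inE ?eqxx ?js ?orbT.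
    by rewrite inE => /orP[/eqP ->|/Es].
  split; first exact: measurableI.
  rewrite setCI (le_trans (measureU2 _ _ _)) //; try exact: measurableC.
  by rewrite -natr1 mulrDl mul1r addrC EFinD leeD // -compl.
move=> /(_ (enum I)); rewrite -cardE.
have -> : [set w | forall i, i \in enum I -> E i w] = [set w | forall i, E i w].
  apply/seteqP; split => w /= Ew i; last by move=> _; exact: Ew.
  by apply: Ew; rewrite mem_enum.
by move=> [mEI]; rewrite -compl.
Qed.

End Probability.

(** * From bounds with slack to the theorem *)

Lemma finite_gap (R : realFieldType) (I : finType) (f : I -> R) (c : R) :
  exists2 d, 0 < d & forall i, f i < c + d -> f i <= c.
Proof.
(* The gap is the distance from [c] to the least value above it, or 1 if there is none. *)
have [/existsP[i0 ci0]|/existsPn none] := boolP [exists i, c < f i]; last first.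
  by exists 1 => // i _; rewrite leNgt none.
case: (@arg_minP _ _ _ i0 (fun i => c < f i) f ci0) => i ci iP.
exists (f i - c); rewrite ?subr_gt0 // => j.
by rewrite addrC subrK => ji; rewrite leNgt; apply/negP => /iP; rewrite leNgt ji.
Qed.

Theorem theorem3p7 (R : realType) (disp : measure_display)
  (Omega : measurableType disp) (P : probability Omega R) (c0 : R -> R)
  (N m r l k : nat) (F : 'I_m -> 'cV[R]_N) (eps : R)
  (A : 'I_r -> 'I_N -> {RV P >-> R})
  (S : Omega -> 'I_l -> {set 'I_m})
  (B : Omega -> 'I_l -> {vspace 'cV[R]_N}) :
  (0 < N)%N -> (0 < m)%N -> (0 < r)%N -> (0 < l)%N -> (0 < k)%N ->
  (l < m)%N -> (k < N)%N ->
  normalized F ->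
  (k <= \rank (data_mx F))%N ->
  0 < eps < 1 ->
  random_matrix A ->
  concentration A c0 ->
  (forall w, optimal_partition k (fun i => sample A w *m F i) (S w)) ->
  (forall w, bundle_generated_by k F (S w) (B w)) ->
  exists E : set Omega,
    [/\ measurable E,
        ((1 - (2 * m%:R ^+ 2 + 4 * m%:R) * expR (- (r%:R * c0 eps)))%:E
           < P E)%E
      & forall w, E w ->
          bundle_error F (B w) <=
          (1 + eps) * min_error k l F
          + eps * Num.sqrt (l%:R * ((\rank (data_mx F))%:R - k%:R))].
Proof.
move=> _ m_gt0 _ l_gt0 _ _ _ normF kd eps01 _ conc optS genB.
have /andP[eps_gt0 eps_lt1] := eps01; have eps0 := ltW eps_gt0.
have [_ concP] := conc eps eps01.
set e0 := min_error k l F; set c := (1 + eps) * e0 + _.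
(* The event depends on the bundle [B0] for [F]. Since [phi] has finitely many
   values, a nearly optimal [B0] is enough: the infimum need not be attained. *)
pose phi (X : {ffun 'I_l -> {set 'I_m}}) := \sum_i fit_error k F (X i).
have [d d_gt0 gap] := finite_gap phi c.
(* Slack [d / 2] suffices: it gets multiplied by [1 + eps], which is below 2. *)
have [|B0 kB0 B0d] := @min_error_adherent _ _ k _ _ F (d / 2) l_gt0.
  by rewrite divr_gt0.
have [cl clP] := nearest_subspace F B0 l_gt0.
have /choice[p pP] : forall j, exists v,
    v \in B0 (cl j) /\ dist (F j) (B0 (cl j)) = l2norm (F j - v).
  by move=> j; have [v ? ?] := dist_attained (F j) (B0 (cl j)); exists v.
pose x (i : ('I_m * 'I_m) + 'I_m) :=
  match i with inl ij => polar_vector F ij | inr j => F j - p j end.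
have [mE PE] := probability_forall_ge
  (fun i => measurable_almost_isometric A eps (x i)) (fun i => concP (x i)).
exists [set w | forall i, almost_isometric eps (sample A w) (x i)]; split=> //.
  apply: lt_le_trans PE; rewrite lte_fin card_sum card_prod card_ord.
  rewrite ltrD2l ltrN2 mulrA ltr_pM2r ?expR_gt0 // natrD natrM.
  (* The union bound loses [2 * (m ^ 2 + m)] exponentials, strictly fewer than allowed because [m]
     is positive. *)
  have : 1 <= m%:R :> R by rewrite ler1n.
  nra.
move=> w Ew.
have partS : is_partition (S w) by case: (optS w) => ? [_ []].
apply: (le_trans (generated_bundle_error_le partS (genB w))).
have -> : \sum_i fit_error k F (S w i) = phi (finfun (S w)).
  by apply: eq_bigr => i _; rewrite ffunE.
apply: gap; rewrite /phi; under eq_bigr do rewrite ffunE.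
have le1 := partition_fit_error_le eps0 normF (fun ij => Ew (inl ij)) (optS w).
have le2 := bundle_image_error l_gt0 eps0 kB0 clP pP (fun j => Ew (inr j)).
apply: (le_lt_trans le1).
have : (1 + eps) * bundle_error F B0 < (1 + eps) * e0 + d.
  have : (1 + eps) * bundle_error F B0 < (1 + eps) * (e0 + d / 2).
    by rewrite ltr_pM2l // ltr_wpDr.
  nra.
(* The factor [l] is at least 1, and [kd] makes the truncated difference agree with the real one. *)
have : eps * Num.sqrt (\rank (data_mx F) - k)%:R <=
    eps * Num.sqrt (l%:R * ((\rank (data_mx F))%:R - k%:R)).
  rewrite ler_wpM2l // natrB //; apply: ler_wsqrtr; rewrite ler_peMl ?ler1n //.
  by rewrite subr_ge0 ler_nat.
rewrite /c; lra.
Qed.
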